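(* Let $k=p^r$ where $p$ is prime, $r\in\mathbb{N}$, and $k>2$. Suppose $G$ is a connected $n$-vertex simple graph with $m$ edges, and $T$ is a spanning tree of $G$. Then the following statements hold. (i) Let $q=\lfloor k/2\rfloor$. Let $G'$ be the multigraph obtained from $G$ by adding $q-1$ parallel edges to each edge $e\in E(G)-E(T)$ (so each such edge has multiplicity $q$ in $G'$). If $\chi_{DP}(G')\le k$ and $m\le n\bigl(1+(k-2)/q\bigr)-1+1/q$, then $$P_{DP}(G,k)\ge k^{(n(q+k-2)-qm+1-q)/(k-1)}.$$ (ii) If $\chi_{DP}(G)\le k$ and $m\le 2n-\frac{k-3}{k-2}$, then $$P_{DP}(G,k)\ge k^{((2n-m)(k-2)-(k-3))/(k-1)}.$$
   Context: All multigraphs are finite and loopless. For a multigraph $G$ and vertices $u,v$, $e_G(u,v)$ is the number of edges joining $u$ and $v$; the underlying simple graph of $G$ has an edge $uv$ exactly when $e_G(u,v)\ge1$. For a finite set $A$, $S_A$ is the symmetric group on $A$. For nonempty $S\subseteq S_A$, an $S$-labeling of $G$ is a pair $(D,\sigma)$ where $D$ is an orientation of the underlying simple graph of $G$ and $\sigma$ assigns to each arc $(u,v)$ of $D$ an $e_G(u,v)$-tuple of elements of $S$ (a single element of $S$ when $G$ is simple). A proper $S$-coloring of $(D,\sigma)$ is a map $\kappa:V(G)\to A$ such that for every arc $(u,v)\in E(D)$ and every coordinate $\pi$ of $\sigma(u,v)$, $\pi(\kappa(u))\ne\kappa(v)$; it is a proper $S$-$k$-coloring if $|\kappa(V(G))|\le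 k$. $P_S(G,k)$ is the minimum, over all $S$-labelings $(D,\sigma)$ of $G$, of the number of proper $S$-$k$-colorings of $(D,\sigma)$. With $|A|=k$, the DP color function is $P_{DP}(G,k)=P_{S_A}(G,k)$. $G$ is DP-$k$-colorable if every $S_A$-labeling of $G$ with $|A|=k$ has a proper $S_A$-$k$-coloring, and the DP-chromatic number $\chi_{DP}(G)$ is the least such $k$. *)

(* Defs.v *)
From mathcomp Require Import all_boot all_fingroup.

Set Implicit Arguments.
Unset Strict Implicit.
Unset Printing Implicit Defensive.

(** Finite loopless multigraphs, given by their edge multiplicities. *)
Record mgraph (V : finType) := MGraph {
  mult : V -> V -> nat;
  mult_sym : forall u v, mult u v = mult v u;
  mult_loopless : forall u, mult u u = 0
}.

Record sgraph (V : finType) := SGraph {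
  adj :> rel V;
  adj_sym : symmetric adj;
  adj_irr : irreflexive adj
}.

Section Graphs.
Variable V : finType.
Implicit Types (G T : sgraph V) (H : mgraph V).

Fact sg_mult_sym G u v : (G u v : nat) = G v u.
Proof. by rewrite adj_sym. Qed.

Fact sg_mult_loopless G u : (G u u : nat) = 0.
Proof. by rewrite adj_irr. Qed.

Definition mgraph_of_sgraph G : mgraph V :=
  MGraph (sg_mult_sym G) (sg_mult_loopless G).

Fact underlying_sym H : symmetric [rel u v | 0 < mult H u v].
Proof. by move=> u v /=; rewrite mult_sym. Qed.

Fact underlying_irr H : irreflexive [rel u v | 0 < mult H u v].
Proof. by move=> u /=; rewrite mult_loopless. Qed.

Definition underlying H : sgraph V :=
  SGraph (underlying_sym H) (underlying_irr H).

(** Unordered pairs; by irreflexivity of [G] each has two elements. *)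
Definition edges G : {set {set V}} :=
  [set [set a.1; a.2] | a : V * V & G a.1 a.2].

Definition connected G : Prop :=
  0 < #|V| /\ forall u v : V, connect G u v.

Definition acyclic G : Prop :=
  forall c : seq V, 2 < size c -> ~~ ucycleb G c.

Definition is_tree G : Prop := connected G /\ acyclic G.

Definition spanning_tree T G : Prop := subrel T G /\ is_tree T.

Section AddParallel.
Variables (G T : sgraph V) (j : nat).

Definition add_parallel_mult (u v : V) : nat :=
  G u v + (if G u v && ~~ T u v then j else 0).

Fact add_parallel_sym u v : add_parallel_mult u v = add_parallel_mult v u.
Proof. by rewrite /add_parallel_mult (adj_sym G) (adj_sym T). Qed.

Fact add_parallel_loopless u : add_parallel_mult u u = 0.
Proof. by rewrite /add_parallel_mult adj_irr. Qed.

(** [j] parallel edges are added to each edge in [E(G) - E(T)]. *)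
Definition add_parallel : mgraph V :=
  MGraph add_parallel_sym add_parallel_loopless.

End AddParallel.
End Graphs.

Coercion mgraph_of_sgraph : sgraph >-> mgraph.

Section Labelings.
Variables (V : finType) (G : mgraph V) (A : finType).

(** A pair (D, sigma), where D is a set of ordered pairs.  For typing
    convenience sigma has a value on every ordered pair of vertices; only its
    values on the arcs in D are ever used. *)
Definition labeling : finType :=
  ({set V * V} * {dffun forall a : V * V, (mult G a.1 a.2).-tuple {perm A}})%type.

(** Each adjacent pair is oriented in exactly one of the two directions. *)
Definition is_orientation (D : {set V * V}) : bool :=
  [forall u, forall v,
    if underlying G u v then ((u, v) \in D) (+) ((v, u) \in D)
    else (u, v) \notin D].

Definition is_labeling (S : {set {perm A}}) (L : labeling) : bool :=
  is_orientation L.1 &&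
  [forall a in L.1, all (fun s : {perm A} => s \in S) (L.2 a)].

Definition proper_coloring (L : labeling) (f : {ffun V -> A}) : bool :=
  [forall a in L.1, all (fun s : {perm A} => s (f a.1) != f a.2) (L.2 a)].

Definition proper_kcoloring (L : labeling) (k : nat) (f : {ffun V -> A}) :=
  proper_coloring L f && (#|f @: [set: V]| <= k).

Definition ncolorings (L : labeling) (k : nat) : nat :=
  #|[set f | proper_kcoloring L k f]|.

(** The default value is the number of all maps V -> A, which bounds every
    [ncolorings L k]; see [PS_min]. *)
Definition PS (S : {set {perm A}}) (k : nat) : nat :=
  \big[minn/#|{ffun V -> A}|]_(L : labeling | is_labeling S L) ncolorings L k.

Lemma exists_labeling (S : {set {perm A}}) :
  S != set0 -> exists L, is_labeling S L.
Proof.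
case/set0Pn=> s sS.
pose D := [set a : V * V | (0 < mult G a.1 a.2) && (enum_rank a.1 < enum_rank a.2)].
exists (D, [ffun a : V * V => [tuple of nseq (mult G a.1 a.2) s]]
           : {dffun forall a : V * V, (mult G a.1 a.2).-tuple {perm A}}).
apply/andP; split => /=.
  apply/forallP=> u; apply/forallP=> v /=; rewrite !inE /= (mult_sym G v u).
  case: ifP => [Guv|-> //]; case: (ltngtP (enum_rank u) (enum_rank v)) => //=.
    by rewrite Guv.
    by rewrite Guv.
  by move=> /val_inj/enum_rank_inj uv; rewrite uv mult_loopless in Guv.
apply/forallP=> a; apply/implyP=> _; rewrite ffunE /=.
by rewrite all_nseq sS orbT.
Qed.

Lemma PS_min (S : {set {perm A}}) (k : nat) : S != set0 ->
  (exists2 L, is_labeling S L & PS S k = ncolorings L k) /\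
  (forall L, is_labeling S L -> PS S k <= ncolorings L k).
Proof.
move=> S0.
have le L : is_labeling S L -> PS S k <= ncolorings L k.
  move=> SL; rewrite /PS -big_filter.
  have : L \in [seq i <- index_enum (labeling : finType) | is_labeling S i].
    by rewrite mem_filter SL mem_index_enum.
  elim: filter => //= x r IH; rewrite inE big_cons geq_min.
  by case/predU1P=> [<-|/IH ->]; rewrite ?leqnn ?orbT.
split=> //.
have [L0 SL0] := exists_labeling S0.
have [] : PS S k = #|{ffun V -> A}| \/
          exists2 L, is_labeling S L & PS S k = ncolorings L k.
- rewrite /PS; elim/big_ind: _ => [|x y Hx Hy|L SL].
  + by left.
  + by rewrite /minn; case: ifP.
  + by right; exists L.
- move=> E; exists L0 => //; apply/eqP; rewrite eqn_leq le //= E.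
  exact: max_card.
- by [].
Qed.

End Labelings.

Section DP.
Variable V : finType.
Implicit Type G : mgraph V.

(** The colour set A with |A| = k is taken to be 'I_k. *)
Definition PDP G (k : nat) : nat := PS G [set: {perm 'I_k}] k.

Definition dp_colorable G (k : nat) : bool :=
  [forall L : labeling G 'I_k, is_labeling [set: {perm 'I_k}] L ==>
    [exists f, proper_kcoloring L k f]].

Lemma exists_dp_colorable G : exists k, dp_colorable G k.
Proof.
pose d := \sum_u \sum_v (mult G v u + mult G u v); exists d.+1.
have dle x : \sum_v (mult G v x + mult G x v) <= d.
  by rewrite /d [X in _ <= X](bigD1 x) //= leq_addr.
clearbody d.
apply/forallP=> -[D s]; apply/implyP=> /andP[/= /forallP oD _].
pose ok (f : {ffun V -> 'I_d.+1}) (u v : V) :=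
  (u, v) \in D -> all (fun t : {perm _} => t (f u) != f v) (s (u, v)).
suff /(_ (enum V) (enum_uniq _)) [f Hf] :
    forall r : seq V, uniq r -> exists f, {in r &, forall u v, ok f u v}.
  apply/existsP; exists f; apply/andP; split; last first.
    by apply: leq_trans (max_card _) _; rewrite card_ord.
  apply/forallP=> -[u v]; apply/implyP=> /=.
  by apply: Hf; rewrite mem_enum.
elim=> [_|x r IH /= /andP[xr ur]]; first by exists [ffun=> ord0].
have [f Hf] := IH ur.
pose F := flatten [seq [seq (t : {perm _}) (f v) | t <- s (v, x)] ++
   [seq (t : {perm _})^-1%g (f v) | t <- s (x, v)] | v <- enum V].
have szF : size F < d.+1.
  rewrite ltnS size_flatten /shape -map_comp sumnE big_map big_enum /=.
  apply: leq_trans (dle x).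
  by apply: leq_sum => v _; rewrite size_cat !size_map !size_tuple.
have [c cF] : exists c : 'I_d.+1, c \notin F.
  apply/existsP; apply: contraLR szF; rewrite negb_exists => /forallP FF.
  suff le_d : #|'I_d.+1| <= size F by rewrite -leqNgt -{1}(card_ord d.+1).
  apply: leq_trans (card_size F); apply/subset_leq_card/subsetP => c _.
  by have := FF c; rewrite negbK.
have Dxx : (x, x) \notin D.
  by have /forallP/(_ x) := oD x; rewrite /= mult_loopless.
exists [ffun v => if v == x then c else f v] => u v.
rewrite !inE /ok !ffunE.
case: (eqVneq u x) => [->|ux] /=; case: (eqVneq v x) => [->|vx] /=.
- by rewrite (negPf Dxx).
- move=> _ vr Dxv; apply/allP => t ts; apply: contra cF => /eqP tc.
  apply/flatten_mapP; exists v; first by rewrite mem_enum.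
  rewrite mem_cat; apply/orP; right; apply/mapP; exists t => //.
  by rewrite -tc permK.
- move=> ur' _ Dux; apply/allP => t ts; apply: contra cF => /eqP tc.
  apply/flatten_mapP; exists u; first by rewrite mem_enum.
  by rewrite mem_cat; apply/orP; left; apply/mapP; exists t.
- by move=> ur' vr; apply: Hf.
Qed.

Definition chiDP G : nat := ex_minn (exists_dp_colorable G).

End DP.

(* Main.v *)
Require Import Defs.
From mathcomp Require Import all_boot all_order all_fingroup all_algebra reals exp.
From mathcomp Require Import finfield zify ring.

Set Implicit Arguments.
Unset Strict Implicit.
Unset Printing Implicit Defensive.

(** Identify the [k] colours with the field [F] of order [k]. A function on [F^n]
    given by a polynomial of degree [d] that is not identically zero has at least
    [k^(n - d/(k-1))] nonzeros, so it suffices to find a polynomial of small degree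
    whose nonzeros are proper colourings. Permuting the colours at each vertex
    turns the permutations on the tree edges into the identity, and these edges
    contribute the linear factors [x_u - x_v]. A non-tree edge contributes either
    one factor [s(x_u) - x_v], where the permutation [s] of [F] is a polynomial of
    degree at most [k - 2], or, in part (i), [k/2] linear factors
    [a x_u + b - x_v] whose lines cover the graph of [s]. DP-colourability of [G]
    or [G'] says precisely that the product of these factors does not vanish
    identically. *)

Import Order.TTheory GRing.Theory Num.Theory.

(** * Trees, orientations and DP-colourability *)

Section Trees.
Variables (V : finType) (T : sgraph V).
Implicit Types (S : {set V}) (u v x y : V).

(** Induction along edges: a set that no edge leaves is closed under [connect], so a nonempty one is
    everything; any other set can absorb a new vertex. *)
Lemma connected_grow (P : {set V} -> Prop) : connected T ->
  (forall x, P [set x]) ->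
  (forall S u v, P S -> u \in S -> v \notin S -> T u v -> P (v |: S)) ->
  P [set: V].
Proof.
case=> /card_gt0P[x0 _] cT P1 Pgrow.
have [S [PS0 S0]] : exists S, P S /\ x0 \in S by exists [set x0]; rewrite inE.
move En: #|~: S| => n; elim: n S PS0 S0 En => [|n IH] S PS0 S0 En.
  suff <- : S = [set: V] by [].
  apply/setP=> x; have /eqP := En; rewrite cards_eq0 => /eqP/setP/(_ x).
  by rewrite !inE => /negbFE.
have [[u v] /= /and3P[uS vS Tuv]] :
    exists a : V * V, [&& a.1 \in S, a.2 \notin S & T a.1 a.2].
  apply/existsP; apply: contraPT (En) => /existsPn noedge.
  have clS : closed T S.
    apply: intro_closed; first exact: sym_connect_sym (adj_sym T).
    by move=> x y Txy xS; have := noedge (x, y); rewrite /= xS Txy andbT negbK.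
  suff -> : ~: S = set0 by rewrite cards0.
  by apply/setP=> y; rewrite !inE -(closed_connect clS (cT x0 y)) S0.
apply: (IH (v |: S)); [exact: Pgrow uS vS Tuv | by rewrite !inE S0 orbT |].
have := cardsC S; have := cardsC (v |: S); rewrite cardsU1 vS; lia.
Qed.

(** Each absorbed vertex brings an edge to the part already grown, and this edge did not lie inside
    the smaller set. *)
Lemma connected_card_edges : connected T -> (#|V| <= #|edges T|.+1)%N.
Proof.
move=> cT; rewrite -cardsT.
suff : #|[set: V]| <= #|[set e in edges T | e \subset [set: V]]|.+1.
  by move/leq_trans; apply; rewrite ltnS subset_leq_card //;
    apply/subsetP=> e; rewrite inE => /andP[].
apply: (connected_grow (P := fun S => #|S| <= #|[set e in edges T | e \subset S]|.+1)) => //.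
  by move=> x; rewrite cards1.
move=> S u v leS uS vS Tuv; rewrite cardsU1 vS add1n ltnS.
apply: leq_trans leS _; apply: proper_card; apply/properP; split.
  apply/subsetP=> e; rewrite !inE => /andP[-> /= eS].
  by rewrite (subset_trans eS) // subsetUr.
exists [set u; v].
  rewrite inE; apply/andP; split; first by apply/imsetP; exists (u, v); rewrite ?inE.
  by apply/subsetP=> w; rewrite !inE => /orP[] /eqP ->; rewrite ?eqxx ?uS ?orbT.
rewrite inE negb_and; apply/orP; right.
by apply/subsetPn; exists v; rewrite // !inE eqxx orbT.
Qed.

(* While the vertex set [S] grows along edges of [T], acyclicity makes the
   neighbour of a new vertex in [S] unique, so the potential extends. *)
Lemma tree_potential (gT : finGroupType) (w : V -> V -> gT) : is_tree T ->
  (forall u v, T u v -> w v u = (w u v)^-1)%g ->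
  exists rho : V -> gT, forall u v, T u v -> rho v = (rho u * w u v)%g.
Proof.
case=> cT aT wV.
(* [T_ S] is [T] restricted to [S]. The invariant also keeps [S] connected inside itself, so that
   two neighbours in [S] of a new vertex are joined by a path avoiding that vertex. *)
pose T_ S := [rel x y | [&& T x y, x \in S & y \in S]].
suff [_ [rho Hrho]] : {in [set: V] &, forall x y, connect (T_ [set: V]) x y} /\
    exists rho : V -> gT, {in [set: V] &, forall u v, T u v -> rho v = (rho u * w u v)%g}.
  by exists rho => u v; apply: Hrho; rewrite inE.
apply: (connected_grow (P := fun S => {in S &, forall x y, connect (T_ S) x y} /\
    exists rho : V -> gT, {in S &, forall u v, T u v -> rho v = (rho u * w u v)%g})) => //.
  move=> z; split=> [x y|]; first by rewrite !inE => /eqP-> /eqP->.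
  by exists (fun=> 1%g) => x y; rewrite !inE => /eqP-> /eqP->; rewrite adj_irr.
move=> S u v [cS [rho Hrho]] uS vS Tuv.
have symT S' : connect_sym (T_ S').
  by apply: sym_connect_sym => x y /=; rewrite adj_sym andbA andbAC -andbA.
split.
  have sub x y : connect (T_ S) x y -> connect (T_ (v |: S)) x y.
    apply: connect_sub => a b /and3P[Tab aS bS]; apply: connect1.
    by rewrite /= Tab !inE aS bS !orbT.
  have from_u x : x \in v |: S -> connect (T_ (v |: S)) u x.
    rewrite !inE => /predU1P[->|xS]; last exact/sub/cS.
    by apply: connect1; rewrite /= Tuv !inE uS eqxx orbT.
  by move=> x y /from_u ux /from_u uy; rewrite symT in ux; apply: connect_trans uy.
(* A second neighbour [x] would close a cycle [v, x, ..., u] through a simple path in [S]; it has at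
   least three vertices because [x] differs from [u]. *)
have uniq_nbr x : x \in S -> T x v -> x = u.
  move=> xS Txv; apply/eqP/negPn/negP => xu.
  have /connectP[p0 p0P Eu] := cS _ _ xS uS.
  case: (shortenP p0P) Eu => p pP p_uniq _ Eu.
  have pS : {subset p <= S}.
    elim: p x {xS Txv xu p0P p_uniq Eu} pP => // y p IH x /= /andP[/and3P[_ _ yS] yp] z.
    by rewrite inE => /predU1P[->|/(IH _ yp)].
  have vp : v \notin x :: p.
    rewrite inE negb_or; apply/andP; split; first by apply: contra vS => /eqP ->.
    by apply: contra vS => /pS.
  have p_gt0 : (0 < size p)%N by case: (p) Eu xu => //= ->; rewrite eqxx.
  have /negP := aT [:: v, x & p] p_gt0; apply.
  apply/andP; split; last by rewrite cons_uniq vp.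
  rewrite /= (adj_sym T) Txv /= rcons_path -Eu Tuv andbT.
  by apply: sub_path pP => a b /and3P[].
exists (fun x => if x == v then (rho u * w u v)%g else rho x) => x y.
rewrite !inE; case: (eqVneq x v) => [->|xv] /=; case: (eqVneq y v) => [->|yv] //=.
- by rewrite adj_irr.
- move=> _ yS Tvy; rewrite (uniq_nbr y yS) 1?adj_sym //.
  by rewrite (wV _ _ Tuv) mulgK.
- by move=> xS _ Txv; rewrite (uniq_nbr x xS Txv).
- by move=> xS yS; apply: Hrho.
Qed.

End Trees.

(** Sending an arc to its unordered pair is a bijection: the exclusive or yields an arc over each
    edge and forbids both directions at once. *)
Lemma card_orientation (V : finType) (G : sgraph V) (D : {set V * V}) :
  is_orientation G D -> #|D| = #|edges G|.
Proof.
move=> /forallP oD.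
have orient u v : G u v -> ((u, v) \in D) (+) ((v, u) \in D).
  by move=> Guv; have /forallP/(_ v) := oD u; rewrite /= Guv.
have DG u v : (u, v) \in D -> G u v.
  by move=> Duv; have /forallP/(_ v) := oD u; rewrite /= Duv; case: (G u v).
rewrite -(card_in_imset (f := fun a : V * V => [set a.1; a.2])).
  congr #|pred_of_set _|; apply/setP=> e; apply/imsetP/imsetP => [[[u v] Duv ->]|].
    by exists (u, v) => //; rewrite inE /= DG.
  case=> -[u v]; rewrite inE /= => Guv ->.
  have [Duv|Duv] := boolP ((u, v) \in D); first by exists (u, v).
  have := orient u v Guv; rewrite (negPf Duv) /= => Dvu.
  by exists (v, u); rewrite // setUC.
move=> [u v] [x y] /= Duv Dxy E.
have := orient u v (DG _ _ Duv); rewrite Duv /= => Dvu.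
have uv : u != v by apply: contraTneq (DG _ _ Duv) => ->; rewrite adj_irr.
have: u \in [set x; y] by rewrite -E !inE eqxx.
have: v \in [set x; y] by rewrite -E !inE eqxx orbT.
rewrite !inE => /orP[] /eqP Ev /orP[] /eqP Eu; move: uv Dvu; subst; rewrite ?eqxx //.
by rewrite Dxy.
Qed.

Lemma is_orientation_adj (V : finType) (G : sgraph V) (D : {set V * V}) a :
  is_orientation G D -> a \in D -> G a.1 a.2.
Proof.
case: a => u v /forallP/(_ u)/forallP/(_ v) /=.
by case: (G u v) => //= /negPf ->.
Qed.

(* Composing with a transposition makes a permutation of ['I_j.+1] fix
   [ord_max] without changing the values different from [ord_max]. *)
Lemma perm_restrict_ord j (t : {perm 'I_j.+1}) :
  exists s : {perm 'I_j}, forall a b,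
    t (lift ord_max a) = lift ord_max b -> s a = b.
Proof.
pose u := (t * tperm ord_max (t ord_max))%g.
have u_max : u ord_max = ord_max by rewrite permM tpermR.
have u_lift a : ord_max != u (lift ord_max a).
  by rewrite -[X in X != _]u_max (inj_eq perm_inj) neq_lift.
pose f a := odflt a (unlift ord_max (u (lift ord_max a))).
have fP a : lift ord_max (f a) = u (lift ord_max a).
  by rewrite /f; have [b -> ->] := unlift_some (u_lift a).
have fI : injective f.
  by move=> a b ab; apply/(@lift_inj _ ord_max)/(@perm_inj _ u); rewrite -!fP ab.
exists (perm fI) => a b tab; rewrite permE; apply: (@lift_inj _ ord_max).
rewrite fP permM tab tpermD ?neq_lift //.
by rewrite -tab (inj_eq perm_inj) neq_lift.
Qed.

Section DPColorable.
Variables (V : finType) (H : mgraph V).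

(** Colour without using [ord_max]: a conflict of [t] between lifted colours is a conflict of its
    restriction [r t] on [j] colours. *)
Lemma dp_colorableS j : dp_colorable H j -> dp_colorable H j.+1.
Proof.
move=> /forallP Hj; apply/forallP=> -[D s]; apply/implyP=> /andP[/= oD _].
have [r rP] := fin_all_exists (@perm_restrict_ord j).
pose s' : {dffun forall a : V * V, (mult H a.1 a.2).-tuple {perm 'I_j}} :=
  [ffun a => [tuple of map r (s a)]].
have /existsP[f /andP[/forallP fP _]] : [exists f, proper_kcoloring (D, s') j f].
  apply: (implyP (Hj (D, s'))); rewrite /is_labeling /= oD /=.
  by apply/forallP=> a; apply/implyP=> _; apply/allP=> t _; rewrite inE.
apply/existsP; exists [ffun v => lift ord_max (f v)]; apply/andP; split; last first.
  by apply: leq_trans (max_card _) _; rewrite card_ord.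
apply/forallP=> a; apply/implyP=> aD; apply/allP=> t ts; rewrite !ffunE.
have /implyP/(_ aD)/allP := fP a; rewrite ffunE => /(_ (r t)).
rewrite map_f // => /(_ isT); apply: contraNneq => /rP ->; exact: eqxx.
Qed.

(** The minimum [chiDP H] is itself a colourable value; monotonicity in the number of colours
    carries this up to [k]. *)
Lemma chiDP_colorable k : (chiDP H <= k)%N -> dp_colorable H k.
Proof.
rewrite /chiDP; case: ex_minnP => j Hj _; elim: k => [|k IH].
  by rewrite leqn0 => /eqP <-.
rewrite leq_eqVlt => /predU1P[<- //|]; rewrite ltnS => /IH; exact: dp_colorableS.
Qed.

End DPColorable.

(** * Nonzeros of polynomial functions over a finite field *)

(** A form of the fact that [ln (x + 1) / x] decreases. With [K = k - 1] and [s = K - t] it reads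
    [k^(k-1-t) <= (k-t)^(k-1)], which compares the [k - t] nonzeros on a line with a power of
    [k]. *)
Lemma expn_succ_le s K : s <= K -> (K.+1) ^ s <= (s.+1) ^ K.
Proof.
elim: K => [|K IH]; first by rewrite leqn0 => /eqP ->.
rewrite leq_eqVlt => /predU1P[-> //|]; rewrite ltnS => sK.
suff step j : j <= K -> (K.+2) ^ j <= j.+1 * (K.+1) ^ j.
  rewrite (leq_trans (step s sK)) // expnS leq_mul2l IH ?orbT //.
elim: j => // j IHj jK; rewrite !expnS.
apply: (@leq_trans (j.+1 * K.+2 * K.+1 ^ j)).
  by rewrite mulnAC mulnC leq_mul2r IHj ?orbT // ltnW.
by rewrite mulnA leq_mul2r; apply/orP; right; nia.
Qed.

Local Open Scope ring_scope.

Section PolynomialFunctions.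
Variables (F : finFieldType) (V : finType).
Implicit Types (U : {set V}) (f g : {ffun V -> F} -> F) (x : {ffun V -> F}).

(** Functions having a polynomial expression of degree at most [d] in the coordinates from [U]. With
    functions in place of formal polynomials, [polyfun_ext] absorbs identities such as
    [y ^+ #|F| = y]. *)
Inductive polyfun U : nat -> ({ffun V -> F} -> F) -> Prop :=
| polyfun_const d c : polyfun U d (fun=> c)
| polyfun_var d v : v \in U -> polyfun U d.+1 (fun x => x v)
| polyfun_add d f g : polyfun U d f -> polyfun U d g ->
    polyfun U d (fun x => f x + g x)
| polyfun_mul d e f g : polyfun U d f -> polyfun U e g ->
    polyfun U (d + e) (fun x => f x * g x)
| polyfun_ext d f g : f =1 g -> polyfun U d f -> polyfun U d g.

Lemma polyfun_leq U d e f : (d <= e)%N -> polyfun U d f -> polyfun U e f.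
Proof.
move=> le_de Uf; elim: Uf e le_de => {d f}.
- by move=> d c e _; apply: polyfun_const.
- by move=> d v vU [//|e] _; apply: polyfun_var.
- by move=> d f g _ IHf _ IHg e de; apply: polyfun_add; [apply: IHf|apply: IHg].
- move=> d d' f g _ IHf _ IHg e de.
  have -> : e = (d + (e - d))%N by rewrite subnKC // (leq_trans _ de) ?leq_addr.
  apply: polyfun_mul; first exact: IHf.
  by apply: IHg; rewrite leq_subRL ?(leq_trans _ de) ?leq_addr.
- by move=> d f g fg _ IHf e de; apply: (polyfun_ext fg); apply: IHf.
Qed.

Lemma polyfun_sum U d (I : Type) (r : seq I) (P : pred I)
    (f : I -> {ffun V -> F} -> F) :
  (forall i, P i -> polyfun U d (f i)) ->
  polyfun U d (fun x => \sum_(i <- r | P i) f i x).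
Proof.
move=> Uf; elim: r => [|i r IH].
  by apply: polyfun_ext (polyfun_const U d 0) => x; rewrite big_nil.
case Pi: (P i).
  by apply: polyfun_ext (polyfun_add (Uf _ Pi) IH) => x; rewrite big_cons Pi.
by apply: polyfun_ext IH => x; rewrite big_cons Pi.
Qed.

Lemma polyfun_prod U (I : Type) (r : seq I) (P : pred I) (d : I -> nat)
    (f : I -> {ffun V -> F} -> F) :
  (forall i, P i -> polyfun U (d i) (f i)) ->
  polyfun U (\sum_(i <- r | P i) d i) (fun x => \prod_(i <- r | P i) f i x).
Proof.
move=> Uf; elim: r => [|i r IH].
  by rewrite big_nil; apply: polyfun_ext (polyfun_const U 0 1) => x; rewrite big_nil.
rewrite big_cons; case Pi: (P i).
  by apply: polyfun_ext (polyfun_mul (Uf _ Pi) IH) => x; rewrite big_cons Pi.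
by apply: polyfun_ext IH => x; rewrite big_cons Pi.
Qed.

Lemma polyfun_horner U d (p : {poly F}) v : v \in U -> (size p <= d.+1)%N ->
  polyfun U d (fun x => p.[x v]).
Proof.
move=> vU sp.
have Xn i : polyfun U i (fun x => x v ^+ i).
  elim: i => [|i IH]; first exact: polyfun_const.
  apply: polyfun_ext (polyfun_mul (polyfun_var 0 vU) IH) => x.
  by rewrite exprS.
apply: (@polyfun_ext _ _ (fun x => \sum_(i < size p) p`_i * x v ^+ i)).
  by move=> x; rewrite horner_coef.
apply: polyfun_sum => i _; apply: (@polyfun_leq _ (0 + i)).
  by rewrite -ltnS (leq_trans (ltn_ord i)).
exact: polyfun_mul (polyfun_const _ _ _) (Xn i).
Qed.

Lemma polyfun_eq U d f x (y : {ffun V -> F}) : polyfun U d f -> {in U, x =1 y} -> f x = f y.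
Proof.
move=> Uf xy; elim: Uf => {d f} //=.
- by move=> d f g _ -> _ ->.
- by move=> d e f g _ -> _ ->.
- by move=> d f g fg _ IH; rewrite -!fg.
Qed.

(* Uses [y ^+ #|F| = y] to bring the exponents of [x v] below [#|F|]. *)
Lemma polyfun_split U d f v : polyfun U d f ->
  exists g : nat -> {ffun V -> F} -> F,
    [/\ forall i, (i <= d)%N -> polyfun (U :\ v) (d - i) (g i),
        forall i, (d < i)%N -> g i =1 fun=> 0
      & forall x, f x = \sum_(i < #|F|) x v ^+ i * g i x].
Proof.
have F1 : (1 < #|F|)%N := finNzRing_gt1 F.
pose o0 := Ordinal (ltnW F1); pose o1 := Ordinal F1.
elim=> {d f}.
- move=> d c; exists (fun i _ => if i == 0%N then c else 0); split.
  + by move=> i _; apply: polyfun_const.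
  + by case.
  + move=> x; rewrite (bigD1 o0) //= mul1r big1 ?addr0 // => i /negPf i0.
    by rewrite [_ == _ :> nat]i0 mulr0.
- move=> d w wU; have [->|wv] := eqVneq w v.
    exists (fun i _ => if i == 1%N then 1 else 0); split.
    + by move=> i _; apply: polyfun_const.
    + by case=> [|[|]] //.
    + move=> x; rewrite (bigD1 o1) //= mulr1 big1 ?addr0 ?expr1 // => i /negPf i0.
      by rewrite [_ == _ :> nat]i0 mulr0.
  exists (fun i x => if i == 0%N then x w else 0); split.
  + case=> [|i] _; first by apply: polyfun_var; rewrite !inE wv.
    exact: polyfun_const.
  + by case.
  + move=> x; rewrite (bigD1 o0) //= mul1r big1 ?addr0 // => i /negPf i0.
    by rewrite [_ == _ :> nat]i0 mulr0.
- move=> d f g _ [f' [Uf f0 Ef]] _ [g' [Ug g0 Eg]].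
  exists (fun i x => f' i x + g' i x); split.
  + by move=> i di; apply: polyfun_add; [apply: Uf|apply: Ug].
  + by move=> i di x; rewrite f0 // g0 // addr0.
  + by move=> x; rewrite Ef Eg -big_split; apply: eq_bigr => i _; rewrite mulrDr.
- move=> d e f g _ [f' [Uf f0 Ef]] _ [g' [Ug g0 Eg]].
  (* Both exponents are below [#|F|], so subtracting [#|F| - 1] at most once brings their sum below
     [#|F|], and the degree can only drop. *)
  pose red i := if (i < #|F|)%N then i else (i - #|F|).+1.
  have red_le i : (red i <= i)%N by rewrite /red; case: ifP; lia.
  have red_lt (i j : 'I_#|F|) : (red (i + j) < #|F|)%N.
    by move: (ltn_ord i) (ltn_ord j); rewrite /red; case: ifP; lia.
  have redX (y : F) i : y ^+ red i = y ^+ i.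
    rewrite /red; case: ltnP => // Fi.
    by rewrite -[in RHS](subnK Fi) exprD expf_card exprSr.
  exists (fun l x => \sum_(i < #|F|) \sum_(j < #|F| | red (i + j)%N == l)
            f' i x * g' j x); split.
  + move=> l lde; apply: polyfun_sum => i _; apply: polyfun_sum => j /eqP <-.
    have [di|id] := ltnP d i.
      by apply: polyfun_ext (polyfun_const _ _ 0) => x; rewrite f0 // mul0r.
    have [ej|je] := ltnP e j.
      by apply: polyfun_ext (polyfun_const _ _ 0) => x; rewrite g0 // mulr0.
    apply: polyfun_leq (polyfun_mul (Uf _ id) (Ug _ je)).
    by have := red_le (i + j)%N; lia.
  + move=> l lde x; rewrite big1 // => i _; rewrite big1 // => j /eqP El.
    have [di|id] := ltnP d i; first by rewrite f0 // mul0r.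
    have [ej|je] := ltnP e j; first by rewrite g0 // mulr0.
    by have := red_le (i + j)%N; lia.
  + move=> x; rewrite Ef Eg.
    under [RHS]eq_bigr do rewrite big_distrr.
    rewrite [RHS]exchange_big big_distrl; apply: eq_bigr => i _ /=.
    under [RHS]eq_bigr do rewrite big_distrr.
    rewrite /= (exchange_big_dep xpredT) //= big_distrr; apply: eq_bigr => j _ /=.
    rewrite (big_pred1 (Ordinal (red_lt i j))) => [|l] /=.
      by rewrite redX exprD; ring.
    by rewrite eq_sym.
- move=> d f g fg _ [h [Uh h0 Eh]]; exists h; split=> // x.
  by rewrite -fg.
Qed.

(* A weak form of the Alon-Furedi theorem. *)
Lemma card_polyfun_neq0 U d f x0 : polyfun U d f -> f x0 != 0 ->
  (#|F| ^ (#|V| * #|F|.-1) <= #|[set x | f x != 0%R]| ^ #|F|.-1 * #|F| ^ d)%N.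
Proof.
have F1 : (1 < #|F|)%N := finNzRing_gt1 F.
(* The induction shrinks [U], while nonzeros are always counted among all functions from [V] to
   [F]. *)
move En: #|U| => n; elim: n U d f x0 En => [|n IH] U d f x0 En Uf f0.
  have U0 : U = set0 by apply/eqP; rewrite -cards_eq0 En.
  have -> : [set x | f x != 0] = setT.
    apply/setP=> x; rewrite !inE.
    by rewrite (@polyfun_eq _ _ _ x x0 Uf) // => v; rewrite U0 inE.
  rewrite cardsT card_ffun -expnM leq_pmulr // expn_gt0; lia.
have [v vU] : exists v, v \in U by apply/card_gt0P; rewrite En.
have [g [Ug g0 Ef]] := polyfun_split v Uf.
have [t0 gt0] : exists t : 'I_#|F|, [exists x, g t x != 0].
  apply/existsP; apply: contraNT f0 => /existsPn gz; rewrite Ef big1 // => i _.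
  have := gz i; rewrite negb_exists => /forallP/(_ x0); rewrite negbK => /eqP ->.
  by rewrite mulr0.
(* [t] is the reduced degree of [f] in [x v]: the largest index whose coefficient function is not
   identically zero. *)
have [t /existsP[x1 gt1] tmax] :
    {t : 'I_#|F| | [exists x, g t x != 0]
      & forall i : 'I_#|F|, (t < i)%N -> forall x, g i x = 0}.
  case: (@arg_maxnP _ t0 (fun i : 'I_#|F| => [exists x, g i x != 0]) val) => //.
  move=> t gt tm; exists t => // i ti x; apply/eqP; apply: contraLR ti => gi.
  by rewrite -leqNgt; apply: tm; apply/existsP; exists x.
have td : (t <= d)%N.
  by rewrite leqNgt; apply: contra gt1 => dt; rewrite g0.
have cardU : #|U :\ v| = n by have := cardsD1 v U; rewrite vU En => -[].
have {}IH := IH _ _ _ _ cardU (Ug _ td) gt1.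
pose upd x c : {ffun V -> F} := [ffun w => if w == v then c else x w].
have updv x c : upd x c v = c by rewrite ffunE eqxx.
have g_upd i x c : (i <= d)%N -> g i (upd x c) = g i x.
  move=> di; apply: (polyfun_eq (Ug _ di)) => w; rewrite !inE ffunE.
  by case/andP=> /negPf ->.
(* Where the leading coefficient is nonzero, [f] along the direction [v] is a polynomial of degree
   exactly [t], hence has at most [t] roots. *)
have line x : g t x != 0 -> (#|F| - t <= \sum_c (f (upd x c) != 0)%R)%N.
  move=> gx; pose p := \poly_(i < t.+1) g i x.
  have sp : size p = t.+1 by rewrite size_poly_eq.
  have Ep c : f (upd x c) = p.[c].
    rewrite Ef horner_poly (big_ord_widen #|F| (fun i => g i x * c ^+ i)) //.
    rewrite [RHS]big_mkcond; apply: eq_bigr => i _; rewrite updv ltnS; case: leqP => it.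
      by rewrite g_upd 1?mulrC // (leq_trans it).
    by rewrite tmax // mulr0.
  have p0 : p != 0 by rewrite -size_poly_eq0 sp.
  have rts : (#|[set c | p.[c] == 0%R]| <= t)%N.
    rewrite -ltnS -sp cardE; apply: max_poly_roots; rewrite ?enum_uniq //.
    by apply/allP=> c; rewrite mem_enum inE.
  have -> : (\sum_c (f (upd x c) != 0)%R = #|~: [set c | p.[c] == 0%R]|)%N.
    rewrite -sum1_card [RHS]big_mkcond; apply: eq_bigr => c _.
    by rewrite !inE Ep; case: eqP.
  by rewrite leq_subLR -[leqLHS](cardsC [set c | p.[c] == 0]) leq_add2r.
set N := #|[set x | f x != 0]|; set M := #|[set x | g t x != 0]| in IH.
have count : (M * (#|F| - t) <= #|F| * N)%N.
  have <- : (\sum_x \sum_c (f (upd x c) != 0)%R = #|F| * N)%N.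
    rewrite pair_big /=.
    (* Exchanging [c] with [x v] is an involution on pairs; it shows that every nonzero of [f] is
       counted [#|F|] times. *)
    pose h (a : {ffun V -> F} * F) := (upd a.1 a.2, a.1 v).
    have hK : cancel h h.
      move=> [x c]; rewrite /h /= updv; congr pair; apply/ffunP=> w.
      by rewrite !ffunE; case: eqP => [->|].
    rewrite (reindex_inj (can_inj hK)) /=.
    rewrite (eq_bigr (fun a => (f a.1 != 0 : nat))) => [|a _]; last first.
      congr (nat_of_bool (f _ != 0)); apply/ffunP=> w.
      by rewrite !ffunE; case: eqP => [->|].
    rewrite -(pair_big xpredT xpredT (fun x (c : F) => (f x != 0 : nat))) /=.
    under eq_bigr do rewrite sum_nat_const.
    rewrite -big_distrr /=; congr (_ * _)%N.
    by rewrite -big_mkcond sum1dep_card.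
  rewrite -sum_nat_const [leqRHS](bigID [in [set x | g t x != 0]]) /=.
  apply: leq_trans (leq_addr _ _).
  by apply: leq_sum => x; rewrite inE; apply: line.
have tF := ltn_ord t.
(* The [t] points lost on each line cost at most a factor [#|F| ^ t]; together with the degree
   [d - t] left for [g t] this makes up [#|F| ^ d]. *)
have bern : (#|F| ^ #|F|.-1 <= (#|F| - t) ^ #|F|.-1 * #|F| ^ t)%N.
  have := @expn_succ_le (#|F|.-1 - t) #|F|.-1 (leq_subr _ _).
  have -> : (#|F|.-1 - t).+1 = (#|F| - t)%N by lia.
  rewrite (prednK (ltnW F1)) => bern.
  have -> : (#|F| ^ #|F|.-1 = #|F| ^ (#|F|.-1 - t) * #|F| ^ t)%N.
    by rewrite -expnD subnK //; lia.
  by rewrite leq_mul2r bern orbT.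
have Fpos e : (0 < #|F| ^ e)%N by rewrite expn_gt0 ltnW.
have le2 : (((#|F| - t) * M) ^ #|F|.-1 <= (#|F| * N) ^ #|F|.-1)%N.
  by rewrite leq_exp2r 1?mulnC //; lia.
have Ed : (#|F| ^ d = #|F| ^ t * #|F| ^ (d - t))%N by rewrite -expnD subnKC.
rewrite -(leq_pmul2l (Fpos #|F|.-1)).
apply: leq_trans (leq_mul bern IH) _.
rewrite mulnACA -expnMn -Ed.
by rewrite mulnA -expnMn leq_mul2r le2 orbT.
Qed.

End PolynomialFunctions.

(** * Permutations of a finite field *)

Section FiniteFieldFunctions.
Variable F : finFieldType.
Implicit Types (h : F -> F) (x y a : F).

Lemma expf_card_pred x : x != 0 -> x ^+ #|F|.-1 = 1.
Proof.
move=> x0; apply: (mulfI x0).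
by rewrite -exprS prednK ?expf_card ?mulr1 // ltnW // finNzRing_gt1.
Qed.

(** Multiplication by some [b] other than [0] and [1] permutes the field, so the sum equals [b]
    times itself. *)
Lemma sum_finField : (2 < #|F|)%N -> \sum_(a : F) a = 0.
Proof.
move=> F2; have [b] : exists b : F, b \notin [set 0; 1].
  apply/existsP; apply: contraLR F2; rewrite negb_exists -leqNgt => /forallP all01.
  apply: (@leq_trans #|[set 0; 1 : F]|); last by rewrite cards2; case: eqP.
  by apply/subset_leq_card/subsetP => b _; have := all01 b; rewrite negbK.
rewrite !inE negb_or => /andP[b0 b1].
have : \sum_(a : F) a = b * \sum_(a : F) a.
  by rewrite [LHS](reindex_inj (mulfI b0)) big_distrr.
move/eqP; rewrite -subr_eq0 -{1}[\sum_a a]mul1r -mulrBl mulf_eq0 subr_eq0 eq_sym.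
by rewrite (negPf b1) => /eqP.
Qed.

(* The Lagrange interpolation polynomial of [h] has [X^(#|F|-1)]-coefficient
   [- \sum_a h a], which vanishes for a permutation. *)
Lemma interpolate_injective h : (2 < #|F|)%N -> injective h ->
  exists p : {poly F}, (size p <= #|F|.-1)%N /\ forall x, p.[x] = h x.
Proof.
move=> F2 hI; have F1 : (1 < #|F|)%N := finNzRing_gt1 F.
have pred_neq0 : (#|F|.-1 == 0)%N = false by lia.
(* The factor [1 - ('X - a%:P) ^+ #|F|.-1] takes the value [1] at [a] and [0] elsewhere. *)
pose p : {poly F} := \sum_a h a *: (1 - ('X - a%:P) ^+ #|F|.-1).
have psz a : size (('X - a%:P) ^+ #|F|.-1) = #|F|.
  by rewrite size_exp_XsubC prednK // ltnW.
exists p; split; last first.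
  move=> x; rewrite horner_sum (bigD1 x) //= big1 => [|a ax].
    by rewrite !hornerE /= subrr expr0n pred_neq0 ?subr0 ?mulr1 ?addr0.
  by rewrite !hornerE /= expf_card_pred ?subr_eq0 1?eq_sym // subrr mulr0.
apply/leq_sizeP => j; rewrite leq_eqVlt => /predU1P[<-|jF].
  rewrite coef_sum (eq_bigr (fun a => - h a)) => [|a _]; last first.
    rewrite coefZ coefB coef1 pred_neq0.
    have /monicP : ('X - a%:P) ^+ #|F|.-1 \is monic by rewrite monic_exp ?monicXsubC.
    by rewrite lead_coefE psz => ->; rewrite sub0r mulrN mulr1.
  by rewrite sumrN -(reindex_inj (P := xpredT) (F := id) hI) sum_finField ?oppr0.
rewrite coef_sum big1 // => a _; rewrite coefZ coefB coef1.
case: eqP => [|_]; first by lia.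
by rewrite nth_default ?subr0 ?mulr0 // psz -ltnS; lia.
Qed.

(** Wilson's theorem for finite fields: evaluate at [0] the factorization of ['X^(#|F|.-1) - 1] over
    the nonzero elements, then replace [a] by [- a]. *)
Lemma prod_finField_neq0 : \prod_(a : F | a != 0) a = -1.
Proof.
have F1 : (1 < #|F|)%N := finNzRing_gt1 F.
pose P : {poly F} := \prod_(a | a != 0) ('X - a%:P).
have EP : 'X^(#|F|.-1) - 1 = P.
  have X0 : 'X != 0 :> {poly F} by rewrite polyX_eq0.
  have EF : #|F|.-1.+1 = #|F| by lia.
  apply: (mulfI X0); rewrite mulrBr mulr1 -exprS EF (finField_genPoly F).
  by rewrite (bigD1 (0 : F)) //= polyC0 subr0.
have := congr1 (horner^~ 0) EP; rewrite horner_prod !hornerE /= expr0n.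
have -> : (#|F|.-1 == 0)%N = false by lia.
rewrite sub0r => ->; rewrite (reindex_inj (@oppr_inj F)) /=.
by apply: eq_big => [a|a _]; rewrite ?oppr_eq0 // !hornerE.
Qed.

(** Translation by [1] permutes the field, so comparing sums gives that [#|F|] times [1] is zero; if
    [2] were zero, oddness would make [1] zero. *)
Lemma finField_odd_two_neq0 : odd #|F| -> 2 != 0 :> F.
Proof.
move=> oddF; apply: contra (oner_neq0 F) => /eqP two0.
have : \sum_(x : F) x = \sum_(x : F) (x + 1) by rewrite [LHS](reindex_inj (@addIr F 1)).
move/eqP; rewrite big_split /= sumr_const -subr_eq0 opprD addrA subrr sub0r oppr_eq0.
rewrite -(odd_double_half #|{: F}|) oddF mulrnDr -muln2 mulnC mulrnA.
by rewrite two0 mul0rn addr0.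
Qed.

(* If all slopes from [0] were distinct, their product would be both [-1], by
   Wilson's theorem, and the quotient of two such products. *)
Lemma injective_three_collinear h : odd #|F| -> injective h ->
  exists x y, [/\ x != 0, y != 0, x != y & (h x - h 0) / x = (h y - h 0) / y].
Proof.
move=> oddF hI; pose sl x := (h x - h 0) / x.
have gI : injective (fun x => h x - h 0) by move=> x y /addIr/hI.
have g0 x : (h x - h 0 != 0) = (x != 0) by rewrite subr_eq0 (inj_eq hI).
(* Since division by zero returns zero, [sl 0 = 0] while the other slopes are nonzero: an injective
   [sl] would permute the nonzero elements, and a collision cannot involve [0]. *)
have sl0 x : (sl x != 0) = (x != 0).
  by rewrite mulf_eq0 invr_eq0 negb_or g0 andbb.
have [slI|] := boolP (injectiveb sl).
  have P0 : \prod_(x : F | x != 0) x != 0 by apply/prodf_neq0.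
  have : \prod_(x : F | x != 0) x = 1.
    rewrite [LHS](reindex_inj (injectiveP _ slI)) /= (eq_bigl _ _ sl0) /sl prodf_div.
    suff -> : \prod_(x | x != 0) (h x - h 0) = \prod_(x : F | x != 0) x by rewrite divff.
    by rewrite [RHS](reindex_inj gI) /=; apply: eq_bigl => x; rewrite g0.
  move/eqP; rewrite prod_finField_neq0 eq_sym -subr_eq0 opprK.
  by rewrite -[1 + 1]/(2%:R) (negPf (finField_odd_two_neq0 oddF)).
case/injectivePn=> x [y xy Exy].
exists x, y; split=> //.
  apply: contraNneq xy => x0; move/eqP: (Exy); rewrite x0 {1}/sl invr0 mulr0 eq_sym.
  by rewrite -[_ == _]negbK sl0 negbK eq_sym.
apply: contraNneq xy => y0; move/eqP: (Exy); rewrite y0 {2}/sl invr0 mulr0.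
by rewrite -[_ == _]negbK sl0 negbK.
Qed.

End FiniteFieldFunctions.

Section PermDegree.
Variable F : finFieldType.
Implicit Types (s t : {perm 'I_#|F|}) (i j : 'I_#|F|).

(** Colours are identified with field elements through [enum_val]; [size p <= d.+1] bounds the
    degree by [d]. *)
Definition perm_degree_le d t : Prop :=
  exists p : {poly F}, (size p <= d.+1)%N /\ forall i, p.[enum_val i] = enum_val (t i).

Lemma perm_degree_le1 : perm_degree_le 1 1%g.
Proof. by exists 'X; rewrite size_polyX; split=> // i; rewrite hornerX perm1. Qed.

Lemma perm_degree_le_card t : (2 < #|F|)%N -> perm_degree_le (#|F| - 2) t.
Proof.
move=> F2; pose h (x : F) : F := enum_val (t (enum_rank x)).
have hI : injective h by move=> x y /enum_val_inj/perm_inj/enum_rank_inj.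
have [p [sp ph]] := interpolate_injective F2 hI.
exists p; split; first by rewrite (leq_trans sp) //; lia.
by move=> i; rewrite ph /h enum_valK.
Qed.

Lemma affine_perm (a b : F) : a != 0 -> exists t,
  perm_degree_le 1 t /\ forall i, enum_val (t i) = a * enum_val i + b.
Proof.
move=> a0; pose f (i : 'I_#|F|) : 'I_#|F| := enum_rank (a * enum_val i + b).
have fI : injective f.
  by move=> i j /enum_rank_inj/addIr/(mulfI a0)/enum_val_inj.
have fE i : enum_val (perm fI i) = a * enum_val i + b by rewrite permE enum_rankK.
exists (perm fI); split=> //; exists (a *: 'X + b%:P); split.
  by rewrite size_polyDl size_scale ?size_polyX ?size_polyC //; case: eqP.
by move=> i; rewrite fE !hornerE.
Qed.

(** The line through two points of the graph of [s] has nonzero slope because [s] is injective; when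
    [i = j] a translation serves. *)
Lemma affine_through_two s i j : exists t, [/\ perm_degree_le 1 t, t i = s i & t j = s j].
Proof.
have [<-|ij] := eqVneq i j.
  have [t [dt tE]] := @affine_perm 1 (enum_val (s i) - enum_val i) (oner_neq0 _).
  by exists t; split=> //; apply: enum_val_inj; rewrite tE mul1r addrC subrK.
have dij : enum_val j - enum_val i != 0 :> F.
  by rewrite subr_eq0 (inj_eq enum_val_inj) eq_sym.
pose a : F := (enum_val (s j) - enum_val (s i)) / (enum_val j - enum_val i).
have a0 : a != 0.
  rewrite mulf_neq0 ?invr_eq0 // subr_eq0 (inj_eq enum_val_inj) (inj_eq perm_inj).
  by rewrite eq_sym.
have [t [dt tE]] := @affine_perm a (enum_val (s i) - a * enum_val i) a0.
exists t; split=> //; apply: enum_val_inj; rewrite tE; first by ring.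
by rewrite addrC -addrA [- _ + _]addrC -mulrBr /a divfK // addrC subrK.
Qed.

Lemma affine_cover_seq s q (l : seq 'I_#|F|) : (size l <= q.*2)%N ->
  exists ts : q.-tuple {perm 'I_#|F|},
    {in ts, forall t, perm_degree_le 1 t} /\
    {in l, forall i, exists2 t, t \in ts & t i = s i}.
Proof.
elim: q l => [|q IH] l sl.
  by exists [tuple]; split=> // i; move: sl; rewrite leqn0 size_eq0 => /eqP ->.
have i0 : 'I_#|F| by apply: enum_rank (0 : F).
(* If [l] has fewer than two entries, the default [i0] fills in, and agreement with [s] there is
   harmless. *)
pose i := nth i0 l 0; pose j := nth i0 l 1.
have [t [dt ti tj]] := affine_through_two s i j.
have [|ts [dts cts]] := IH (drop 2 l); first by rewrite size_drop; lia.
exists [tuple of t :: ts]; split=> [t'|x xl].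
  by rewrite inE => /predU1P[->|/dts].
have [->|xi] := eqVneq x i; first by exists t; rewrite ?mem_head.
have [->|xj] := eqVneq x j; first by exists t; rewrite ?mem_head.
have /cts[t' t'ts E] : x \in drop 2 l.
  move: xl xi xj; rewrite /i /j; case: (l) => [|y [|z l']] //=; rewrite ?drop0 !inE.
    by move=> ->.
  by move=> /or3P[-> | -> |].
by exists t'; rewrite // inE t'ts orbT.
Qed.

(* For even [#|F|], cover the graph of [s] two points at a time; for odd [#|F|],
   start from three collinear points. *)
Lemma affine_cover s : (2 < #|F|)%N -> exists ts : (#|F| %/ 2).-tuple {perm 'I_#|F|},
    {in ts, forall t, perm_degree_le 1 t} /\
    forall i, exists2 t, t \in ts & t i = s i.
Proof.
move=> F2; rewrite divn2; have [oddF|evenF] := boolP (odd #|F|); last first.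
  have [|ts [dts cts]] := @affine_cover_seq s #|F|./2 (enum 'I_#|F|).
    by rewrite size_enum_ord even_halfK.
  by exists ts; split=> // i; apply: cts; rewrite mem_enum.
pose h (x : F) : F := enum_val (s (enum_rank x)).
have hI : injective h by move=> x y /enum_val_inj/perm_inj/enum_rank_inj.
have [x [y [x0 y0 xy Exy]]] := injective_three_collinear oddF hI.
set a := (h x - h 0) / x in Exy.
have a0 : a != 0 by rewrite mulf_neq0 ?invr_eq0 // subr_eq0 (inj_eq hI).
have [t [dt tE]] := @affine_perm a (h 0) a0.
have th z : a * z + h 0 = h z -> t (enum_rank z) = s (enum_rank z).
  by move=> E; apply: enum_val_inj; rewrite tE enum_rankK E.
pose A := [set enum_rank z | z in [set 0; x; y]].
have tA : {in A, forall i, t i = s i}.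
  move=> _ /imsetP[z zA ->]; apply: th; move: zA; rewrite !inE => /orP[/orP[]|] /eqP ->.
  - by rewrite mulr0 add0r.
  - by rewrite /a divfK // subrK.
  - by rewrite Exy divfK // subrK.
have cardA : #|A| = 3%N.
  rewrite card_imset; last exact: enum_rank_inj.
  rewrite setUC cardsU1 cards2 !inE (eq_sym 0) (eq_sym y x).
  by rewrite (negPf xy) (negPf x0) (negPf y0).
(* The [#|F| - 3] remaining points are even in number and take one map per pair, one map fewer than
   the total allowed. *)
have [|ts [dts cts]] := @affine_cover_seq s #|F|./2.-1 (enum (~: A)).
  have EA : (3 + #|~: A| = #|F|)%N by rewrite -cardA cardsC card_ord.
  have {EA} -> : size (enum (~: A)) = (#|F| - 3)%N.
    by apply/eqP; rewrite -cardE -(eqn_add2l 3) EA subnKC.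
  by have := odd_double_half #|F|; rewrite oddF; lia.
have Eq : #|F|./2 = #|F|./2.-1.+1 by rewrite prednK // half_gt0; lia.
rewrite Eq; exists [tuple of t :: ts]; split=> [t'|i].
  by rewrite inE => /predU1P[->|/dts].
have [iA|iA] := boolP (i \in A); first by exists t; rewrite ?mem_head ?tA.
have [|t' t'ts E] := cts i; first by rewrite mem_enum inE.
by exists t'; rewrite // inE t'ts orbT.
Qed.

(** * Counting proper colourings *)

Variable V : finType.

(** The product [P] of the factors [t(x_u) - x_v] is nonzero exactly at proper colourings, and [f0]
    is one such point. A factor has degree at most [deg a], where positivity of [deg a] accommodates
    the term [x_v]. *)
Lemma card_proper_coloring (H : mgraph V) (L : labeling H 'I_#|F|)
    (deg : V * V -> nat) f0 :
  (forall a, (0 < deg a)%N) ->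
  (forall a, a \in L.1 -> {in L.2 a, forall t, perm_degree_le (deg a) t}) ->
  proper_coloring L f0 ->
  (#|F| ^ (#|V| * #|F|.-1) <= #|[set f | proper_coloring L f]| ^ #|F|.-1 *
     #|F| ^ (\sum_(a in L.1) mult H a.1 a.2 * deg a))%N.
Proof.
move=> deg_gt0 degL Lf0.
pose col (x : {ffun V -> F}) : {ffun V -> 'I_#|F|} := [ffun v => enum_rank (x v)].
pose P (x : {ffun V -> F}) : F := \prod_(a in L.1) \prod_(t <- L.2 a)
  (enum_val ((t : {perm _}) (enum_rank (x a.1))) - x a.2).
have P0 x : (P x != 0) = proper_coloring L (col x).
  apply/prodf_neq0/forallP => [Px a|Px a aL].
    apply/implyP=> aL; have := Px a aL; rewrite prodf_seq_neq0.
    apply: sub_all => t; rewrite implyTb !ffunE; apply: contraNneq => tx.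
    by rewrite tx enum_rankK subrr.
  rewrite prodf_seq_neq0; have /implyP/(_ aL) := Px a.
  apply: sub_all => t; rewrite implyTb !ffunE; apply: contraNneq => /eqP.
  by rewrite subr_eq0 => /eqP <-; rewrite enum_valK.
have Ppol : polyfun [set: V] (\sum_(a in L.1) mult H a.1 a.2 * deg a) P.
  apply: polyfun_prod => a aL.
  have -> : (mult H a.1 a.2 * deg a = \sum_(t <- L.2 a) deg a)%N.
    by rewrite big_const_seq count_predT size_tuple iter_addn_0 mulnC.
  rewrite big_seq; apply: (@polyfun_ext _ _ _ _ (fun x : {ffun V -> F} =>
    \prod_(t <- L.2 a | t \in L.2 a)
      (enum_val ((t : {perm _}) (enum_rank (x a.1))) - x a.2))).
    by move=> x; rewrite -big_seq.
  apply: polyfun_prod => t /(degL _ aL)[p [sp pt]].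
  apply: (@polyfun_ext _ _ _ _ (fun x => p.[x a.1] + (-1) * x a.2)).
    by move=> x; rewrite mulN1r -pt enum_rankK.
  apply: polyfun_add; first by apply: polyfun_horner; rewrite ?inE.
  apply: (@polyfun_leq _ _ _ (0 + 1)); first exact: deg_gt0.
  by apply: polyfun_mul; [apply: polyfun_const | apply: polyfun_var; rewrite inE].
have Px0 : P [ffun v => enum_val (f0 v)] != 0.
  rewrite P0; suff -> : col [ffun v => enum_val (f0 v)] = f0 by [].
  by apply/ffunP=> v; rewrite !ffunE enum_valK.
apply: leq_trans (card_polyfun_neq0 Ppol Px0) _.
rewrite leq_mul2r; apply/orP; right.
rewrite leq_exp2r ?ltn_predRL ?finNzRing_gt1 //.
rewrite -(card_in_imset (f := col)).
  by apply/subset_leq_card/subsetP=> _ /imsetP[x + ->]; rewrite !inE P0.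
move=> x y _ _ /ffunP E; apply/ffunP=> v.
by have := E v; rewrite !ffunE => /enum_rank_inj.
Qed.

(* Recolouring each vertex [v] through [rho v] and replacing each permutation by
   a list covering its graph only makes the labeling more restrictive. *)
Lemma card_proper_coloring_cover (G : sgraph V) (L : labeling G 'I_#|F|) (H : mgraph V)
    (rho : V -> {perm 'I_#|F|}) (deg : V * V -> nat) :
  is_orientation G L.1 -> (forall u v, (0 < mult H u v)%N = G u v) ->
  dp_colorable H #|F| -> (forall a, (0 < deg a)%N) ->
  (forall a, a \in L.1 -> exists ts : (mult H a.1 a.2).-tuple {perm 'I_#|F|},
     {in ts, forall t, perm_degree_le (deg a) t} /\
     {in L.2 a, forall s i,
        exists2 t, t \in ts & t i = (rho a.1 * s * (rho a.2)^-1)%g i}) ->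
  (#|F| ^ (#|V| * #|F|.-1) <= #|[set f | proper_coloring L f]| ^ #|F|.-1 *
     #|F| ^ (\sum_(a in L.1) mult H a.1 a.2 * deg a))%N.
Proof.
move=> oL HG /forallP dpH deg_gt0 covL.
have /fin_all_exists[tau tauP] : forall a : V * V,
    exists ta : (mult H a.1 a.2).-tuple {perm 'I_#|F|},
    a \in L.1 -> {in ta, forall t, perm_degree_le (deg a) t} /\
     {in L.2 a, forall s i,
        exists2 t, t \in ta & t i = (rho a.1 * s * (rho a.2)^-1)%g i}.
  move=> a; have [aL|aL] := boolP (a \in L.1).
    by have [ts tsP] := covL a aL; exists ts.
  (* Off the arcs of [L.1] any tuple will do. *)
  by exists [tuple of nseq _ 1%g].
pose L' : labeling H 'I_#|F| := (L.1, [ffun a => tau a] : {dffun forall a, _}).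
have /existsP[f0 /andP[Lf0 _]] : [exists f, proper_kcoloring L' #|F| f].
  apply: (implyP (dpH L')); apply/andP; split.
    apply/forallP=> u; apply/forallP=> v; rewrite /= HG.
    by have /forallP/(_ u)/forallP/(_ v) := oL; rewrite /=; case: (G u v).
  by apply/forallP=> a; apply/implyP=> _; apply/allP=> t _; rewrite inE.
have degL' a : a \in L'.1 -> {in L'.2 a, forall t, perm_degree_le (deg a) t}.
  by move=> aL t; rewrite ffunE => tt; have [+ _] := tauP a aL; apply.
apply: leq_trans (card_proper_coloring deg_gt0 degL' Lf0) _.
rewrite leq_mul2r; apply/orP; right.
rewrite leq_exp2r ?ltn_predRL ?finNzRing_gt1 //.
pose up (g : {ffun V -> 'I_#|F|}) : {ffun V -> 'I_#|F|} := [ffun v => rho v (g v)].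
rewrite -(card_in_imset (f := up)) => [|g g' _ _ /ffunP E]; last first.
  by apply/ffunP=> v; have := E v; rewrite !ffunE => /perm_inj.
apply/subset_leq_card/subsetP=> _ /imsetP[g + ->]; rewrite !inE => /forallP gP.
apply/forallP=> a; apply/implyP=> aL; apply/allP=> s sL; rewrite !ffunE.
have [_ /(_ s sL (g a.1)) [t tt tE]] := tauP a aL.
have /implyP/(_ aL)/allP/(_ t) := gP a; rewrite ffunE => /(_ tt).
by rewrite tE !permM; apply: contraNneq => ->; rewrite permK.
Qed.

(** Common core of both parts: a tree edge costs degree [1] and any other edge costs [c], the number
    of its factors times their degree. *)
Lemma PDP_lower_bound (G T : sgraph V) (H : mgraph V) (deg : V * V -> nat) c :
  spanning_tree T G -> (0 < c)%N ->
  (forall u v, (0 < mult H u v)%N = G u v) -> dp_colorable H #|F| ->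
  (forall a, (0 < deg a)%N) ->
  (forall a, G a.1 a.2 -> mult H a.1 a.2 * deg a = if T a.1 a.2 then 1 else c)%N ->
  (forall a s, G a.1 a.2 -> (T a.1 a.2 -> s = 1%g) ->
     exists ts : (mult H a.1 a.2).-tuple {perm 'I_#|F|},
     {in ts, forall t, perm_degree_le (deg a) t} /\
     forall i, exists2 t, t \in ts & t i = s i) ->
  (#|V| <= #|edges G|.+1)%N /\
  (#|F| ^ (#|V| * #|F|.-1) <= PDP G #|F| ^ #|F|.-1 *
     #|F| ^ (#|V|.-1 + (#|edges G| - #|V|.-1) * c))%N.
Proof.
move=> [TG tT] c_gt0 HG dpH deg_gt0 degH cov.
have S0 : [set: {perm 'I_#|F|}] != set0 by apply/set0Pn; exists 1%g; rewrite inE.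
have [[L /andP[oL _] PS_L] _] := PS_min G #|F| S0.
have oriented u v : G u v -> ((u, v) \in L.1) (+) ((v, u) \in L.1).
  by move=> Guv; have /forallP/(_ u)/forallP/(_ v) := oL; rewrite /= Guv.
have LG a : a \in L.1 -> G a.1 a.2 by apply: is_orientation_adj.
(* As [G] is simple, the tuple on an arc has a single entry, and [head] extracts it. *)
pose pi (a : V * V) : {perm 'I_#|F|} := head 1%g (L.2 a).
have piE a s : a \in L.1 -> s \in L.2 a -> s = pi a.
  move=> /LG Ga; have : size (L.2 a) = 1%N by rewrite size_tuple /= Ga.
  rewrite /pi -[s \in L.2 a]/(s \in tval (L.2 a)).
  by case: (tval _) => [|x [|y l]] //= _; rewrite inE => /eqP.
(* [w u v] is the permutation carried from [u] to [v], inverted when the arc runs the other way. A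
   potential [rho] for it makes [rho u * w u v * (rho v)^-1] the identity on tree edges. *)
pose w u v : {perm 'I_#|F|} := if (u, v) \in L.1 then pi (u, v) else (pi (v, u))^-1%g.
have wV u v : T u v -> (w v u = (w u v)^-1)%g.
  move=> /TG/oriented; rewrite /w.
  by case: ((u, v) \in L.1); case: ((v, u) \in L.1); rewrite // invgK.
have [rho rhoP] := tree_potential tT wV.
have oT : is_orientation T [set a in L.1 | T a.1 a.2].
  apply/forallP=> u; apply/forallP=> v; rewrite /= !inE /= (adj_sym T v u).
  by have [/TG/oriented|] := boolP (T u v); rewrite ?andbT ?andbF.
have cardT := card_orientation oT; have cardG := card_orientation oL.
have leT := connected_card_edges tT.1.
have leTG : (#|edges T| <= #|edges G|)%N.
  by rewrite -cardT -cardG; apply/subset_leq_card/subsetP => a; rewrite inE => /andP[].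
split; first exact: leq_trans leT _.
have bound : (#|F| ^ (#|V| * #|F|.-1) <= #|[set f | proper_coloring L f]| ^ #|F|.-1 *
     #|F| ^ (\sum_(a in L.1) mult H a.1 a.2 * deg a))%N.
  apply: (card_proper_coloring_cover (rho := rho)) => // a aL.
  have [|ts [dts cts]] := cov a (rho a.1 * pi a * (rho a.2)^-1)%g (LG _ aL).
    move=> Ta; rewrite (rhoP _ _ Ta) /w; case: (a) aL => u v /= ->.
    by rewrite mulgV.
  by exists ts; split=> // s /(piE _ _ aL) -> .
have -> : PDP G #|F| = #|[set f | proper_coloring L f]|.
  rewrite /PDP PS_L; congr #|pred_of_set _|; apply/setP=> f.
  rewrite !inE /proper_kcoloring andb_idr // => _; apply: leq_trans (max_card _) _.
  by rewrite card_ord.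
apply: leq_trans bound _; rewrite leq_mul2l; apply/orP; right.
rewrite leq_exp2l ?finNzRing_gt1 //.
have -> : (\sum_(a in L.1) mult H a.1 a.2 * deg a =
    #|edges T| + (#|edges G| - #|edges T|) * c)%N.
  rewrite (eq_bigr (fun a => if T a.1 a.2 then 1 else c)%N) => [|a /LG]; last exact: degH.
  rewrite (bigID (fun a => T a.1 a.2)) /=; congr addn.
    rewrite -cardT -sum1_card; apply: eq_big => [a|a /andP[_ ->] //]; by rewrite inE.
  rewrite (eq_bigr (fun=> c)) => [|a /andP[_ /negPf -> //]].
  rewrite sum_nat_const -cardG -cardT; congr muln.
  rewrite -(cardsID [set a | T a.1 a.2] L.1).
  have -> : L.1 :&: [set a | T a.1 a.2] = [set a in L.1 | T a.1 a.2].
    by apply/setP=> a; rewrite !inE.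
  rewrite addKn; by apply: eq_card => a; rewrite !inE andbC.
(* The tree has at least [#|V|.-1] edges, and counting a tree edge at cost [c >= 1] instead of [1]
   only increases the total. *)
by nia.
Qed.

End PermDegree.

(** * Real exponents and the two lower bounds *)

(** Raising to the power [K] and multiplying by [k ^ d] turns the claim into the natural-number
    inequality. *)
Lemma powR_le_nat (R : realType) (k N E K d : nat) : (0 < k)%N -> (0 < K)%N ->
  (k ^ E <= N ^ K * k ^ d)%N ->
  k%:R `^ ((E%:R - d%:R) / K%:R) <= N%:R :> R.
Proof.
move=> k_gt0 K_gt0 le_kN; have kR : (0 : R) < k%:R by rewrite ltr0n.
rewrite -(@ler_pXn2r _ K) ?nnegrE ?powR_ge0 ?ler0n //.
rewrite -powR_mulrn ?powR_ge0 // -powRrM divfK ?pnatr_eq0 -?lt0n //.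
rewrite -(ler_pM2r (exprn_gt0 d kR)) -!(powR_mulrn d (ltW kR)).
rewrite -powRD; last by rewrite (gt_eqF kR) implybT.
by rewrite subrK !(powR_mulrn _ (ltW kR)) -!natrX -natrM ler_nat.
Qed.

Theorem theorem1p2 (R : realType) (p r k : nat)
    (hp : prime p) (hk : k = (p ^ r)%N) (hk2 : (2 < k)%N)
    (V : finType) (G T : sgraph V) (n m : nat)
    (hn : n = #|V|) (hm : m = #|edges G|)
    (hG : connected G) (hT : spanning_tree T G) :
  (forall q : nat, q = (k %/ 2)%N ->
     (chiDP (add_parallel G T (q - 1)) <= k)%N ->
     m%:R <= n%:R * (1 + (k%:R - 2) / q%:R) - 1 + 1 / q%:R :> R ->
     k%:R `^ ((n%:R * (q%:R + k%:R - 2) - q%:R * m%:R + 1 - q%:R)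
                / (k%:R - 1))
       <= (PDP G k)%:R :> R)
  /\
  ((chiDP G <= k)%N ->
     m%:R <= 2 * n%:R - (k%:R - 3) / (k%:R - 2) :> R ->
     k%:R `^ (((2 * n%:R - m%:R) * (k%:R - 2) - (k%:R - 3)) / (k%:R - 1))
       <= (PDP G k)%:R :> R).
Proof.
have r_gt0 : (0 < r)%N by case: r hk hk2 => // ->; rewrite expn0.
have [F _ cardF] := pPrimePowerField hp r_gt0.
have {cardF} cardF : k = #|F| by rewrite cardF.
move: hk2; rewrite {hk}cardF => F2; have n_gt0 : (0 < n)%N by rewrite hn; case: hG.
have TG : subrel T G := hT.1.
pose lower_bound c := (#|V| <= #|edges G|.+1)%N /\
  (#|F| ^ (#|V| * #|F|.-1) <= PDP G #|F| ^ #|F|.-1 *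
     #|F| ^ (#|V|.-1 + (#|edges G| - #|V|.-1) * c))%N.
have powR_bound (c : nat) : lower_bound c ->
    #|F|%:R `^ ((n%:R * (#|F|%:R - 1) - (n%:R - 1 + (m%:R - (n%:R - 1)) * c%:R))
      / (#|F|%:R - 1)) <= (PDP G #|F|)%:R :> R.
  rewrite /lower_bound -hn -hm => -[le_nm bnd].
  have F0 : (0 < #|F|)%N by lia.
  have F1 : (0 < #|F|.-1)%N by lia.
  have := powR_le_nat R F0 F1 bnd.
  have predE l : (0 < l)%N -> l.-1%:R = l%:R - 1 :> R.
    by case: l => // l _; rewrite -natr1 addrK.
  (* By [le_nm] the truncated subtraction of [n.-1] from [m] is exact, so it casts to the reals. *)
  rewrite natrM natrD natrM natrB; last by lia.
  by rewrite !predE.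
split=> [q qE /chiDP_colorable dpH _|/chiDP_colorable dpG _].
- have q_gt0 : (0 < q)%N by rewrite qE divn_gt0 // ltnW.
  (* Here every factor is affine: one on each tree edge and [q] on each other edge, matching the
     multiplicities of [add_parallel]. *)
  have /powR_bound : lower_bound q.
    apply: (PDP_lower_bound (deg := fun=> 1%N) hT q_gt0 _ dpH) => //.
    + by move=> u v; rewrite /= /add_parallel_mult; case: (G u v); case: (T u v).
    + move=> a Ga; rewrite /= /add_parallel_mult Ga muln1.
      by case: (T _ _) => //=; rewrite add1n subn1 prednK.
    + move=> a s Ga Ts; rewrite /= /add_parallel_mult Ga.
      case: (T _ _) Ts => /= [-> //|_].
        exists [tuple 1%g]; split=> [t|i]; last by exists 1%g; rewrite ?inE.
        by rewrite inE => /eqP ->; apply: perm_degree_le1.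
      have -> : (1 + (q - 1) = #|F| %/ 2)%N by rewrite -qE; lia.
      exact: affine_cover.
  have E (N M K Q : R) : N * (Q + K - 2) - Q * M + 1 - Q =
      N * (K - 1) - (N - 1 + (M - (N - 1)) * Q) by ring.
  by rewrite E.
- have /powR_bound : lower_bound (#|F| - 2)%N.
    (* Here the cover keeps the single permutation: after normalization it is linear on tree edges,
       and has degree at most [#|F| - 2] elsewhere by interpolation. *)
    pose deg (a : V * V) := (if T a.1 a.2 then 1 else #|F| - 2)%N.
    rewrite /lower_bound; apply: (PDP_lower_bound (deg := deg) hT _ _ dpG); rewrite /deg.
    + by rewrite subn_gt0.
    + by move=> u v; rewrite /=; case: (G u v).
    + by move=> a; case: ifP; rewrite ?subn_gt0.
    + by move=> a Ga; rewrite /= Ga mul1n.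
    + move=> a s Ga Ts; rewrite /= Ga; exists [tuple s]; split; last first.
        by move=> i; exists s; rewrite ?inE.
      move=> t; rewrite inE => /eqP ->; case: (T _ _) Ts => [-> //|_].
        exact: perm_degree_le1.
      exact: perm_degree_le_card.
  rewrite natrB; last exact: ltnW.
  have E (N M K : R) : (2 * N - M) * (K - 2) - (K - 3) =
      N * (K - 1) - (N - 1 + (M - (N - 1)) * (K - 2)) by ring.
  by rewrite E.
Qed.
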